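(* Let $(X,f_{1,\infty})$ be a non-autonomous discrete dynamical system generated by a family $f_{1,\infty}=(f_n)_{n\ge1}$ of feeble open maps commuting with a continuous map $f:X\to X$ (that is, $f_n\circ f=f\circ f_n$ for all $n\geq 1$), and let $\mathcal{F}$ be a filterdual and translation invariant Furstenberg family. If $\sum_{i=1}^{\infty}D(f_i,f)<\infty$, then $(X,f)$ is $\mathcal{F}$-sensitive if and only if $(X,f_{1,\infty})$ is $\mathcal{F}$-sensitive.
   Context: A non-autonomous discrete dynamical system $(X,f_{1,\infty})$ consists of a compact metric space $(X,d)$ and a sequence $f_{1,\infty}=(f_n)_{n\ge 1}$ of continuous maps $f_n:X\to X$. Write $f_1^n=f_n\circ\cdots\circ f_1$ for $n\ge1$. The autonomous system $(X,f)$ is the case $f_n=f$ for all $n$, so $f_1^n=f^n$. The family $f_{1,\infty}$ is feeble open if for every non-empty open $U\subseteq X$ the interior of $f_n(U)$ is non-empty for each $n\in\mathbb{N}$. For continuous $f,g:X\to X$, $D(f,g)=\sup_{x\in X}d(f(x),g(x))$. Let $\mathbb{Z}^+=\mathbb{N}$ denote the positive integers and let $\mathcal{P}$ be the collection of all subsets of $\mathbb{Z}^+$. A Furstenberg family is a collection $\mathcal{F}\subseteq\mathcal{P}$ that is hereditary upwards: $F_1\subset F_2$ and $F_1\in\mathcal{F}$ imply $F_2\in\mathcal{F}$. All Furstenberg families are assumed proper, i.e. $\mathcal{F}\neq\emptyset$ and $\mathcal{F}\neq\mathcal{P}$. The dual family is $k\mathcal{F}=\{F\in\mathcal{P}: F\cap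 F'\neq\emptyset \text{ for all } F'\in\mathcal{F}\}=\{F\in\mathcal{P}:\mathbb{Z}^+\setminus F\notin\mathcal{F}\}$. Put $\mathcal{F}_1\cdot\mathcal{F}_2=\{F_1\cap F_2: F_1\in\mathcal{F}_1,F_2\in\mathcal{F}_2\}$. $\mathcal{F}$ is filterdual if it is proper and $k\mathcal{F}\cdot k\mathcal{F}\subseteq k\mathcal{F}$. $\mathcal{F}$ is translation invariant if for every $F\in\mathcal{F}$ and $i\in\mathbb{Z}^+$ both $F+i=\{j+i: j\in F\}$ and $F-i=\{j-i: j\in F\}\cap\mathbb{Z}^+$ belong to $\mathcal{F}$. For a non-empty open $U\subseteq X$ and $\delta>0$, $N_{f_{1,\infty}}(U,\delta)=\{n\in\mathbb{N}:\text{there exist }x,y\in U\text{ with }d(f_1^n(x),f_1^n(y))>\delta\}$. $(X,f_{1,\infty})$ is $\mathcal{F}$-sensitive if there exists $\delta>0$ such that for every $x\in X$ and every open neighbourhood $U$ of $x$, $N_{f_{1,\infty}}(U,\delta)\in\mathcal{F}$. *)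

(* Defs.v *)
From mathcomp Require Import all_boot all_order all_algebra.
From mathcomp Require Import all_classical all_reals all_analysis.

Set Implicit Arguments.
Unset Strict Implicit.
Unset Printing Implicit Defensive.

Import Order.TTheory GRing.Theory Num.Theory.

Local Open Scope classical_set_scope.
Local Open Scope ring_scope.

(** * Furstenberg families *)

(* Subsets of the positive integers are represented as sets of natural numbers
   included in [Zplus]; complements and inclusions are relative to [Zplus]. *)
Definition Zplus : set nat := [set n | (0 < n)%N].

Definition powerZplus : set (set nat) := [set A | A `<=` Zplus].

Definition hereditary_upwards (F : set (set nat)) : Prop :=
  forall A B : set nat, A `<=` B -> B `<=` Zplus -> F A -> F B.

Definition proper_family (F : set (set nat)) : Prop :=
  F !=set0 /\ F <> powerZplus.

(* All Furstenberg families are assumed to be proper. *)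
Definition furstenberg_family (F : set (set nat)) : Prop :=
  [/\ F `<=` powerZplus, hereditary_upwards F & proper_family F].

Definition dual_family (F : set (set nat)) : set (set nat) :=
  [set A | A `<=` Zplus /\ forall B, F B -> A `&` B !=set0].

Definition family_mul (F G : set (set nat)) : set (set nat) :=
  [set A `&` B | A in F & B in G].

Definition filterdual (F : set (set nat)) : Prop :=
  proper_family F /\
  family_mul (dual_family F) (dual_family F) `<=` dual_family F.

Definition translate_up (A : set nat) (i : nat) : set nat :=
  [set (j + i)%N | j in A].

(* Natural subtraction is truncated: an element [j <= i] of [A] is sent to 0,
   which the intersection with [Zplus] discards. *)
Definition translate_down (A : set nat) (i : nat) : set nat :=
  [set (j - i)%N | j in A] `&` Zplus.

Definition translation_invariant (F : set (set nat)) : Prop :=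
  forall (A : set nat) (i : nat), F A -> (0 < i)%N ->
    F (translate_up A i) /\ F (translate_down A i).

(** * Non-autonomous systems *)

(* A sequence of maps (f_n)_{n >= 1} is a function [fs] on [nat] whose value at
   0 is never used. *)

Definition feeble_open (T : topologicalType) (fs : nat -> T -> T) : Prop :=
  forall n, (0 < n)%N -> forall U : set T, open U -> U !=set0 ->
    (fs n @` U)° !=set0.

(* [iter_comp fs n] is f_1^n = f_n o ... o f_1. *)
Fixpoint iter_comp (T : Type) (fs : nat -> T -> T) (n : nat) : T -> T :=
  if n is m.+1 then fs m.+1 \o iter_comp fs m else id.

(* The supremum is finite as soon as [T] is compact and [f], [g] are
   continuous. *)
Definition sup_dist (R : realType) (T : metricType R) (f g : T -> T) : R :=
  sup (range (fun x => mdist (f x) (g x))).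

Definition sens_times (R : realType) (T : metricType R)
    (fs : nat -> T -> T) (U : set T) (delta : R) : set nat :=
  [set n | (0 < n)%N /\ exists x y, [/\ U x, U y &
     delta < mdist (iter_comp fs n x) (iter_comp fs n y)]].

Definition sensitive (R : realType) (T : metricType R)
    (F : set (set nat)) (fs : nat -> T -> T) : Prop :=
  exists2 delta : R, 0 < delta &
    forall (x : T) (U : set T), open U -> U x -> F (sens_times fs U delta).

(* The autonomous system (T, f) is the case f_n = f for all n. *)
Definition autonomous (T : Type) (f : T -> T) : nat -> T -> T := fun=> f.

(* Main.v *)
Require Import Defs.
From mathcomp Require Import all_boot all_order all_algebra.
From mathcomp Require Import all_classical all_reals all_analysis.
From mathcomp Require Import lra.

Set Implicit Arguments.
Unset Strict Implicit.
Unset Printing Implicit Defensive.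

Import Order.TTheory GRing.Theory Num.Theory.

Local Open Scope classical_set_scope.
Local Open Scope ring_scope.

(** Since every f_i commutes with f, the block f_{k+n} o ... o f_{k+1} stays
    uniformly within sum_{i > k} D(f_i, f) of f^n, whatever n is.  Fix k for
    which this tail is small.  If f is sensitive, apply this to an open subset
    of f_1^k(U), which exists by feeble openness: the times of sensitivity of
    f, shifted by k, are times of sensitivity of the family on U.  Conversely,
    a time n > k of the family on U gives points x, y of U for which
    f^{n-k}(f_1^k x) = f_1^k(f^{n-k} x) and f_1^k(f^{n-k} y) are far apart;
    by uniform continuity of f_1^k so are f^{n-k} x and f^{n-k} y. *)

Lemma iter_comp_autonomous (T : Type) (f : T -> T) n :
  iter_comp (autonomous f) n =1 iter n f.
Proof. by elim: n => [//|n ih] x /=; rewrite ih. Qed.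

Lemma iter_compD (T : Type) (fs : nat -> T -> T) k n :
  iter_comp fs (k + n) =1
  iter_comp (fun i => fs (k + i)%N) n \o iter_comp fs k.
Proof.
by elim: n => [x|n ih x]; rewrite ?addn0// addnS /= ih /= addnS.
Qed.

Lemma iter_comp_commute (T : Type) (fs : nat -> T -> T) (f : T -> T) k n :
  (forall i, (0 < i)%N -> fs i \o f =1 f \o fs i) ->
  iter_comp fs k \o iter n f =1 iter n f \o iter_comp fs k.
Proof.
move=> fsf; elim: n => [//|n ihn] x /=; have /= <- := ihn x.
by elim: k {ihn} => [//|k ihk] /=; rewrite ihk; exact: fsf.
Qed.

Lemma continuous_iter_comp (T : topologicalType) (fs : nat -> T -> T) n :
  (forall i, (0 < i)%N -> continuous (fs i)) -> continuous (iter_comp fs n).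
Proof.
move=> cfs; elim: n => [|n ih] x; first exact: cvg_id.
by apply: continuous_comp; [exact: ih|exact: cfs].
Qed.

(** The image of an open set need not be open, so feeble openness of the next map is applied to the
    interior of the previous image. *)
Lemma feeble_open_iter_comp (T : topologicalType) (fs : nat -> T -> T) n
    (U : set T) :
  feeble_open fs -> open U -> U !=set0 -> (iter_comp fs n @` U)° !=set0.
Proof.
move=> ofs oU U0; elim: n => [|n ih].
  by rewrite (_ : _ @` U = U) ?image_id// (interior_id U).1.
have [x] := ofs n.+1 isT _ (@open_interior _ (iter_comp fs n @` U)) ih.
move=> Vx; exists x; move: Vx; apply: interiorS => _ [y /interior_subset Uy <-].
by case: Uy => z Uz <-; exists z.
Qed.

Section metric.
Variables (R : realType) (X : metricType R).
Implicit Types (f g : X -> X) (fs : nat -> X -> X).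

(** Every [M] above [mdist x y + 1] works on the unit ball around [y]; the near-covering form of
    compactness makes one [M] work everywhere. *)
Lemma compact_mdist_bounded (x : X) : compact [set: X] ->
  exists M : R, forall y : X, mdist x y <= M.
Proof.
move=> /compact_near_coveringP cX.
have /= [] := cX R +oo (fun M y => mdist x y <= M) _.
- move=> y _; exists (ball y 1, [set M | mdist x y + 1 < M]) => /=.
    by split; [exact: nbhsx_ballx|exact: nbhs_pinfty_gt (num_real _)].
  move=> [z M] /= []; rewrite ballEmdist /= => yz xM.
  have := metric_triangle x y z; lra.
- by move=> M [_ cM]; exists (M + 1) => y; apply: (cM (M + 1)) => //; lra.
Qed.

(** Near-covering again, with radii tending to 0 from the right: any radius below half of the one
    given by continuity at [x] serves all centres close to [x]. *)
Lemma compact_unif_continuous f (e : R) : compact [set: X] -> continuous f ->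
  0 < e -> exists2 d : R, 0 < d &
    forall x y : X, mdist x y < d -> mdist (f x) (f y) < e.
Proof.
move=> /compact_near_coveringP cX cf e0.
have /= [] := cX R 0^'+ (fun d x =>
  forall y : X, mdist x y < d -> mdist (f x) (f y) < e) _.
- move=> x _.
  have /cf/nbhs_ballP[d /= d0 xd] : nbhs (f x) (ball (f x) (e / 2)).
    by apply: nbhsx_ballx; rewrite divr_gt0.
  have {}xd y : mdist x y < d -> mdist (f x) (f y) < e / 2.
    by move=> xy; have := xd y; rewrite !ballEmdist; apply.
  have d20 : 0 < d / 2 by rewrite divr_gt0.
  exists (ball x (d / 2), [set d' | d' < d / 2]) => /=.
    by split; [exact: nbhsx_ballx|exact: nbhs_right_lt].
  move=> [z d'] /= []; rewrite ballEmdist /= => xz d'd y zy.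
  have xfz : mdist (f x) (f z) < e / 2 by apply: xd; lra.
  have xfy : mdist (f x) (f y) < e / 2.
    by apply: xd; have := metric_triangle x z y; lra.
  by have := metric_triangle (f z) (f x) (f y); rewrite (metric_sym (f z) (f x)); lra.
- move=> r /= r0 rP; exists (r / 2); first by rewrite divr_gt0.
  move=> x; apply: (rP (r / 2)) => //=; last by rewrite divr_gt0.
  by rewrite sub0r normrN gtr0_norm; lra.
Qed.

Lemma mdist_le_sup_dist f g (x : X) : compact [set: X] ->
  mdist (f x) (g x) <= sup_dist f g.
Proof.
move=> cX; have [M ltM] := compact_mdist_bounded (f x) cX.
apply: ub_le_sup; last by exists x.
exists (M + M) => _ [y _ <-].
have := metric_triangle (f y) (f x) (g y).
have := ltM (f y); have := ltM (g y); rewrite (metric_sym (f y) (f x)); lra.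
Qed.

Lemma sup_dist_ge0 f g : compact [set: X] -> 0 <= sup_dist f g.
Proof.
move=> cX; have [/set0P[_ [x _ _]]|] :=
  boolP (range (fun x => mdist (f x) (g x)) != set0).
  by apply: le_trans (mdist_le_sup_dist f g x cX); exact: mdist_ge0.
(* Here [X] is empty, and the supremum of the empty set is 0 by convention. *)
by move=> /negPn/eqP; rewrite /sup_dist => ->; rewrite sup0.
Qed.

(** Commutation turns [f] applied after the first [n] maps into the same [n] maps started at [f x],
    where the induction hypothesis applies. The errors thus add up with no expansion factor from
    [f]. *)
Lemma iter_comp_mdist_le fs f (c : nat -> R) n (x : X) :
  (forall i, (0 < i)%N -> fs i \o f =1 f \o fs i) ->
  (forall i x, (0 < i)%N -> mdist (fs i x) (f x) <= c i) ->
  mdist (iter_comp fs n x) (iter n f x) <= \sum_(1 <= i < n.+1) c i.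
Proof.
move=> fsf cP; elim: n x => [|n ih] x; first by rewrite big_geq// mdistxx.
rewrite big_nat_recr//= addrC -iterS iterSr.
apply: le_trans (metric_triangle _ (f (iter_comp fs n x)) _) _.
rewrite lerD//; first exact: cP.
have /= <- := iter_comp_commute n 1 fsf x; exact: ih.
Qed.

End metric.

Lemma nneseries_tail_small (R : realType) (u : nat -> R) (e : R) :
  (forall i, 0 <= u i) -> (\sum_(1 <= i <oo) (u i)%:E < +oo)%E -> 0 < e ->
  exists2 k, (0 < k)%N & forall n, \sum_(1 <= i < n.+1) u (k + i)%N < e.
Proof.
move=> u0 su e0.
have u0E i : (0 <= (u i)%:E)%E by rewrite lee_fin.
have : (\sum_(N <= i <oo) (u i)%:E @[N --> \oo] --> 0)%E.
  apply: nneseries_tail_cvg => //.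
  (* The tail result wants the series from index 0; the extra term [u 0] is finite. *)
  by rewrite (@nneseries_split _ _ 0 1)//= big_nat1 lte_add_pinfty// ltry.
move=> /fine_cvgP[] /[swap] /cvgrPdist_lt/(_ _ e0).
move=> near_e near_fin.
(* The tail from [k.+2] holds the terms [u (k.+1 + i)] with [1 <= i], and the shift [k.+1] is
   positive. *)
have [k _ /(_ k.+2 (leqW (leqnSn _)))] := filterI near_e near_fin.
move=> [/=]; rewrite sub0r normrN => ke kfin; exists k.+1 => // n.
have -> : \sum_(1 <= i < n.+1) u (k.+1 + i)%N =
    \sum_(k.+2 <= i < n.+1 + k.+1) u i.
  by rewrite -[k.+2]add1n big_addn addnK; under eq_bigr do rewrite addnC.
apply: le_lt_trans ke; rewrite ger0_norm ?fine_ge0 ?nneseries_ge0//.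
by rewrite -lee_fin fineK// -sumEFin; exact: nneseries_lim_ge.
Qed.

Theorem theorem4p2 (R : realType) (X : metricType R)
    (compactX : compact [set: X])
    (fs : nat -> X -> X)
    (cont_fs : forall n, (0 < n)%N -> continuous (fs n))
    (feeble_fs : feeble_open fs)
    (f : X -> X) (cont_f : continuous f)
    (comm_fs : forall n, (0 < n)%N -> fs n \o f = f \o fs n)
    (F : set (set nat))
    (furstF : furstenberg_family F)
    (fdualF : filterdual F)
    (transF : translation_invariant F)
    (sum_fin : (\sum_(1 <= i <oo) (sup_dist (fs i) f)%:E < +oo)%E) :
  sensitive F (autonomous f) <-> sensitive F fs.
Proof.
have fsf i : (0 < i)%N -> fs i \o f =1 f \o fs i.
  by move=> /comm_fs fif x; rewrite fif.
have [_ hF _] := furstF.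
have small (e : R) : 0 < e -> exists2 k, (0 < k)%N & forall n x,
    mdist (iter_comp (fun i => fs (k + i)%N) n x) (iter n f x) < e.
  move=> e0; have [k k0 ke] := nneseries_tail_small
    (fun i => sup_dist_ge0 (fs i) f compactX) sum_fin e0.
  exists k => // n x; apply: le_lt_trans (ke n).
  apply: (iter_comp_mdist_le (c := fun i => sup_dist (fs (k + i)%N) f)).
    by move=> i i0; apply: fsf; rewrite addn_gt0 k0.
  by move=> i y _; exact: mdist_le_sup_dist.
split=> -[d d0 sens].
(* Replacing [f] by the shifted family costs [d / 4] at each of two points, so a separation above
   [d] stays above [d / 2]. *)
- have [|k k0 kd] := small (d / 4); first lra.
  exists (d / 2) => [|x U oU Ux]; first lra.
  have [y Vy] := feeble_open_iter_comp k feeble_fs oU (ex_intro _ x Ux).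
  have [FV _] := transF _ _ (sens y _ (@open_interior _ _) Vy) k0.
  apply: hF FV => [_ [n [n0 [a [b [Va Vb ab]]]] <-]|n []//].
  have [a' Ua' a'a] := interior_subset Va.
  have [b' Ub' b'b] := interior_subset Vb.
  split; first by rewrite addn_gt0 n0.
  exists a', b'; split=> //; rewrite addnC !iter_compD /= a'a b'b.
  move: ab; rewrite !iter_comp_autonomous.
  set A := iter_comp _ n; set B := iter n f.
  have := metric_triangle (B a) (A a) (B b).
  have := metric_triangle (A a) (A b) (B b).
  have := kd n a; have := kd n b; rewrite -/A -/B (metric_sym (B a) (A a)); lra.
- have [|k k0 kd] := small (d / 4); first lra.
  (* Two errors of [d / 4] leave more than [d / 2] between the images under f_1^k, so the modulus is
     taken for [d / 2]. *)
  have [|e e0 ek] := compact_unif_continuous compactX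
    (@continuous_iter_comp _ fs k cont_fs) (_ : 0 < d / 2); first lra.
  (* Denying a separation above [e / 2] gives only a non-strict bound, whereas [ek] asks for a
     distance strictly below [e]. *)
  exists (e / 2) => [|x U oU Ux]; first lra.
  have [_ FU] := transF _ _ (sens x _ oU Ux) k0.
  apply: hF FU => [_ [[n [n0 [a [b [Ua Ub ab]]]] <-] nk]|n []//].
  split=> //; exists a, b; split=> //; rewrite !iter_comp_autonomous.
  rewrite ltNge; apply/negP => abe.
  have /ek : mdist (iter (n - k) f a) (iter (n - k) f b) < e by lra.
  have /= -> := iter_comp_commute k (n - k) fsf a.
  have /= -> := iter_comp_commute k (n - k) fsf b.
  (* Intersecting with [Zplus] left only times with [0 < n - k], so the subtraction is not
     truncated. *)
  have nE : n = (k + (n - k))%N by rewrite subnKC// ltnW// -subn_gt0.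
  move: ab; rewrite nE !iter_compD /= -nE.
  set p := iter_comp fs k a; set q := iter_comp fs k b.
  set A := iter_comp _ (n - k); set B := iter (n - k) f.
  have := metric_triangle (A p) (B p) (A q).
  have := metric_triangle (B p) (B q) (A q).
  have := kd (n - k)%N p; have := kd (n - k)%N q.
  rewrite -/A -/B (metric_sym (B q) (A q)); lra.
Qed.
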